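(* Let $\theta$ be a premetric on $E$ and let $(P_t)$ be a Markov transition function on $E$. For $N>0$ put $d_N(x,y):=N\theta(x,y)\wedge N\theta(y,x)\wedge 1$. \begin{enumerate} \item[(i)] Assume that Assumption A holds for some functions $r,L$. Then for any $N>0$, $t>0$ such that $r(t)\le 1/3$ and $N\ge 2L(t)$, the distance-like function $d_N$ is contracting for $P_t$. \item[(ii)] Assume that Assumption B1 holds for some $t_0>0$ and a set $B\subset E$. Then for any $N>0$ the set $B$ is $d_N$-small for $P_{t_0}$. \item[(iii)] Assume that Assumption B2 holds for some function $R$, a set $B\subset E$ and $\varepsilon>0$. Then for any $N>0$, $t>0$ such that $NR(t)\le\varepsilon/2$, the set $B$ is $d_N$-small for $P_t$. \end{enumerate}
   Context: $(E,\rho)$ is a Polish space with Borel $\sigma$-field $\mathcal E$; $\{P_t(x,A)\}_{t\ge0}$ is a Markov transition function on $E$, $P_t\phi(x)=\int\phi(y)P_t(x,dy)$, and $\mathbb P_x$ denotes the law (in the sense of finite-dimensional distributions) of the Markov process with $X_0=x$ and this transition function. A function $d:E\times E\to\mathbb R_+$ is distance-like if it is symmetric, lower semicontinuous and $d(x,y)=0\iff x=y$. A premetric is a lower semicontinuous $\theta:E\times E\to\mathbb R_+$ with $\theta(x,y)=0\iff x=y$ (not necessarily symmetric). For probability measures $\mu,\nu$, $W_d(\mu,\nu):=\inf_{\lambda\in\mathcal C(\mu,\nu)}\int d\,d\lambda$ over all couplings $\lambda$ of $\mu,\nu$, and $d_{TV}(\mu,\nu)=\sup_A|\mu(A)-\nu(A)|$.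 A distance-like $d$ bounded by $1$ is contracting for $P_t$ if there is $\alpha<1$ such that $W_d(P_t(x,\cdot),P_t(y,\cdot))\le\alpha d(x,y)$ whenever $d(x,y)<1$. A set $B$ is $d$-small for $P_t$ if for some $\varepsilon>0$, $\sup_{x,y\in B}W_d(P_t(x,\cdot),P_t(y,\cdot))\le 1-\varepsilon$. Assumption A: there exist a non-increasing $r:\mathbb R_+\to\mathbb R_+$ with $r(t)\to0$ as $t\to\infty$ and a locally bounded $L:\mathbb R_+\to\mathbb R_+$ such that for any $x,y\in E$ there exist random processes $X^{x,y},Y^{x,y}$ (on a common probability space) with (1) $\mathrm{Law}(X^{x,y})=\mathbb P_x$ and $d_{TV}(\mathrm{Law}(Y^{x,y}_t),P_t(y,\cdot))\le L(t)\theta(x,y)$ for all $t\ge0$; (2) $\mathbb E\theta(X^{x,y}_t,Y^{x,y}_t)\le r(t)\theta(x,y)$ for all $t\ge0$. Assumption B1 (for a set $B$ and $t_0>0$): for any $\varepsilon>0$ there is $D\in\mathcal E$ with $\inf_{x\in B}P_{t_0}(x,D)>0$ and $\sup_{x,y\in D}\theta(x,y)\le\varepsilon$. Assumption B2 (for a set $B$, a non-increasing $R:\mathbb R_+\to\mathbb R_+$ with $R(t)\to0$, and $\varepsilon>0$): for any $x,y\in B$ there exist random processes $X^{x,y},Y^{x,y}$ on a common probability space with (1) $\mathrm{Law}(X^{x,y})=\mathbb P_x$ and $d_{TV}(\mathrm{Law}(Y^{x,y}_t),P_t(y,\cdot))\le1-\varepsilon$ for all $t\ge0$; (2) $\mathbb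 E\theta(X^{x,y}_t,Y^{x,y}_t)\le R(t)$ for all $t\ge0$. *)

(* Defs.v *)
From HB Require Import structures.
From mathcomp Require Import all_boot all_order all_algebra.
From mathcomp Require Import all_classical all_reals all_analysis.
From mathcomp Require Import measurable_realfun.
Set Implicit Arguments.
Unset Strict Implicit.
Unset Printing Implicit Defensive.
Import Order.TTheory GRing.Theory Num.Theory.
Import numFieldNormedType.Exports.
Local Open Scope classical_set_scope.
Local Open Scope ring_scope.

Section Defs.
Context {R : realType} {d : measure_display} {E : measurableType d}.

Definition rho_open (rho : E -> E -> R) (A : set E) : Prop :=
  forall x, A x -> exists e : R, 0 < e /\ (forall y, rho x y < e -> A y).

Definition is_metric (rho : E -> E -> R) : Prop :=
  [/\ forall x y, 0 <= rho x y,
      forall x y, rho x y = 0 <-> x = y,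
      forall x y, rho x y = rho y x &
      forall x y z, rho x z <= rho x y + rho y z].

Definition rho_complete (rho : E -> E -> R) : Prop :=
  forall u : nat -> E,
    (forall e : R, 0 < e -> exists n0, forall m n, (n0 <= m)%N -> (n0 <= n)%N ->
        rho (u m) (u n) < e) ->
    exists l, forall e : R, 0 < e -> exists n0, forall n, (n0 <= n)%N -> rho (u n) l < e.

Definition rho_separable (rho : E -> E -> R) : Prop :=
  exists D : set E, countable D /\
    forall x (e : R), 0 < e -> exists y, D y /\ rho x y < e.

Definition polish_borel (rho : E -> E -> R) : Prop :=
  [/\ is_metric rho, rho_complete rho, rho_separable rho &
      @measurable d E = <<s rho_open rho >>].

Definition lsc2 (rho : E -> E -> R) (f : E -> E -> R) : Prop :=
  forall x y (c : R), c < f x y -> exists delta : R, 0 < delta /\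
    forall x' y', rho x x' < delta -> rho y y' < delta -> c < f x' y'.

Definition premetric (rho : E -> E -> R) (theta : E -> E -> R) : Prop :=
  [/\ forall x y, 0 <= theta x y, lsc2 rho theta &
      forall x y, theta x y = 0 <-> x = y].

Definition distance_like (rho : E -> E -> R) (dd : E -> E -> R) : Prop :=
  [/\ forall x y, 0 <= dd x y, forall x y, dd x y = dd y x, lsc2 rho dd &
      forall x y, dd x y = 0 <-> x = y].

Definition markov_tf (P : R -> E -> probability E R) : Prop :=
  [/\ forall t A, 0 <= t -> measurable A -> measurable_fun [set: E] (fun x => P t x A : \bar R),
      forall x A, measurable A -> P 0 x A = \d_x A &
      forall s t x A, 0 <= s -> 0 <= t -> measurable A ->
        P (s + t) x A = (\int[P s x]_y P t y A)%E].

(** Iterated integral giving P_x(X_{t_1} \in A_1, ..., X_{t_n} \in A_n),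
    for a list [(t_1,A_1); ...; (t_n,A_n)] with 0 <= t_1 <= ... <= t_n;
    [u] is the current time and [x] the current position. *)
Fixpoint fdd_aux (P : R -> E -> probability E R) (u : R) (x : E)
    (s : seq (R * set E)) : \bar R :=
  match s with
  | [::] => 1%E
  | (t, A) :: s' => (\int[P (t - u)%R x]_y ((\1_A y)%:E * fdd_aux P t y s'))%E
  end.

Fixpoint times_ok (u : R) (s : seq (R * set E)) : Prop :=
  match s with
  | [::] => True
  | (t, A) :: s' => u <= t /\ measurable A /\ times_ok t s'
  end.

(** A random process X on (Omega, Pr) with Law(X) = P_x in the sense of
    finite-dimensional distributions. *)
Definition has_law_Px {dO : measure_display} {Omega : measurableType dO}
    (Pr : probability Omega R) (P : R -> E -> probability E R) (x : E)
    (X : R -> Omega -> E) : Prop :=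
  (forall t, 0 <= t -> measurable_fun setT (X t)) /\
  forall s, times_ok 0 s ->
    Pr [set w | forall p, p \in s -> p.2 (X p.1 w)] = fdd_aux P 0 x s.

Definition dTV (mu nu : set E -> \bar R) : \bar R :=
  ereal_sup [set `|(mu A - nu A)%E|%E | A in measurable].

Definition coupling (mu nu : set E -> \bar R) (lam : probability (E * E)%type R)
  : Prop :=
  forall A, measurable A -> lam (A `*` setT) = mu A /\ lam (setT `*` A) = nu A.

Definition W (dd : E -> E -> R) (mu nu : set E -> \bar R) : \bar R :=
  ereal_inf [set (\int[lam]_z (dd z.1 z.2)%:E)%E | lam in coupling mu nu].

Definition contracting (rho : E -> E -> R) (dd : E -> E -> R)
    (P : R -> E -> probability E R) (t : R) : Prop :=
  [/\ distance_like rho dd, forall x y, dd x y <= 1 &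
      exists alpha : R, alpha < 1 /\ forall x y, dd x y < 1 ->
        (W dd (P t x) (P t y) <= (alpha * dd x y)%:E)%E].

Definition small (dd : E -> E -> R) (P : R -> E -> probability E R) (t : R)
    (B : set E) : Prop :=
  exists eps : R, 0 < eps /\
    (ereal_sup [set W dd (P t x) (P t y) | x in B & y in B] <= (1 - eps)%:E)%E.

Definition dN (theta : E -> E -> R) (N : R) : E -> E -> R :=
  fun x y => Num.min (Num.min (N * theta x y) (N * theta y x)) 1.

Definition law_at {dO : measure_display} {Omega : measurableType dO}
    (Pr : probability Omega R) (Y : R -> Omega -> E) (t : R) : set E -> \bar R :=
  fun A => Pr (Y t @^-1` A).

Definition assumptionA (theta : E -> E -> R) (P : R -> E -> probability E R)
    (r L : R -> R) : Prop :=
  [/\ [/\ forall t, 0 <= t -> 0 <= r t,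
          forall s t, 0 <= s -> s <= t -> r t <= r s &
          r x @[x --> +oo] --> (0 : R)],
      [/\ forall t, 0 <= t -> 0 <= L t &
          forall T : R, 0 <= T -> exists M : R, forall t, 0 <= t <= T -> L t <= M] &
      forall x y : E, exists (dO : measure_display) (Omega : measurableType dO)
        (Pr : probability Omega R) (X Y : R -> Omega -> E),
        [/\ has_law_Px Pr P x X,
            forall t, 0 <= t -> measurable_fun setT (Y t),
            forall t, 0 <= t ->
              (dTV (law_at Pr Y t) (P t y) <= (L t * theta x y)%:E)%E &
            forall t, 0 <= t ->
              (\int[Pr]_w (theta (X t w) (Y t w))%:E <= (r t * theta x y)%:E)%E]].

Definition assumptionB1 (theta : E -> E -> R) (P : R -> E -> probability E R)
    (B : set E) (t0 : R) : Prop :=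
  forall eps : R, 0 < eps -> exists D : set E, [/\ measurable D,
    (0 < ereal_inf [set P t0 x D | x in B])%E &
    (ereal_sup [set (theta x y)%:E | x in D & y in D] <= eps%:E)%E].

Definition assumptionB2 (theta : E -> E -> R) (P : R -> E -> probability E R)
    (B : set E) (Rf : R -> R) (eps : R) : Prop :=
  [/\ forall t, 0 <= t -> 0 <= Rf t,
      forall s t, 0 <= s -> s <= t -> Rf t <= Rf s,
      Rf x @[x --> +oo] --> (0 : R) &
      forall x y : E, B x -> B y -> exists (dO : measure_display)
        (Omega : measurableType dO)
        (Pr : probability Omega R) (X Y : R -> Omega -> E),
        [/\ has_law_Px Pr P x X,
            forall t, 0 <= t -> measurable_fun setT (Y t),
            forall t, 0 <= t ->
              (dTV (law_at Pr Y t) (P t y) <= (1 - eps)%:E)%E &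
            forall t, 0 <= t ->
              (\int[Pr]_w (theta (X t w) (Y t w))%:E <= (Rf t)%:E)%E]].

End Defs.

(* Main.v *)
(* Both (i) and (iii) reduce to one bound: if [X] has law [mu], then
   W_c(mu, nu) <= E c(X, Y) + d_TV(Law Y, nu) for every measurable cost
   0 <= c <= 1. No disintegration is needed for the gluing. Write
   Law Y - nu = p - n (Jordan decomposition) with p = f Law Y, 0 <= f <= 1.
   With pi the law of (X, Y), the measure
     (1 - f(y)) pi(dx, dy) + p(E)^-1 (fst_* (f(y) pi))(dx) n(dy)
   couples mu and nu, and its second term has mass p(E) <= d_TV(Law Y, nu).
   For (ii) the product coupling charges D x D, on which d_N <= 1/2. *)

Require Import Defs.
From HB Require Import structures.
From mathcomp Require Import all_boot all_order all_algebra.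
From mathcomp Require Import all_classical all_reals all_analysis.
From mathcomp Require Import measurable_realfun.
From mathcomp Require Import lra.
Set Implicit Arguments.
Unset Strict Implicit.
Unset Printing Implicit Defensive.
Import Order.TTheory GRing.Theory Num.Theory.
Import numFieldNormedType.Exports.
Local Open Scope classical_set_scope.
Local Open Scope ring_scope.

(** * Densities of dominated measures, and lifting them along a map *)

Lemma dominated_density (R : realType) (d : measure_display)
  (T : measurableType d) (mu p : {finite_measure set T -> \bar R}) :
  (forall A, measurable A -> (p A <= mu A)%E) ->
  exists f : T -> R, [/\ measurable_fun setT f, forall x, 0 <= f x <= 1 &
    forall A, measurable A -> p A = (\int[mu]_(x in A) (f x)%:E)%E].
Proof.
move=> pmu.
have dom : p `<< mu.
  apply/null_content_dominatesP => A mA muA0.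
  by apply/eqP; rewrite eq_le measure_ge0 andbT -muA0 pmu.
have [g [g0 ig pE]] := @radon_nikodym_finite _ _ _ mu p dom.
have mg : measurable_fun setT g := measurable_int _ ig.
pose S := [set x | 1%E < g x]%E.
have mS : measurable S by rewrite -[S]setTI; exact: emeasurable_fun_o_infty.
(* For measurable [A] inside [S], the integral of [g] over [A] is [p A], hence at most [mu A], while
   [1 < g] on [S] gives the reverse inequality. So [g] and [1] have the same integrals there and
   agree almost everywhere on [S]. *)
have g1 : ae_eq mu S g (cst 1%E).
  apply: integral_ae_eq => //; first exact: integrableS ig.
  move=> A AS mA; apply/eqP; rewrite eq_le; apply/andP; split.
    by rewrite integral_cst// mul1e -pE// pmu.
  apply: ge0_le_integral => //; first exact: measurable_funTS.
  by move=> x /AS /ltW.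
(* Truncating at [1] gives a real-valued density bounded at every point; it changes [g] only on [S],
   where [g] is already [1] almost everywhere. *)
pose f x := fine (Order.min (g x) 1%E).
have fE x : (f x)%:E = Order.min (g x) 1%E.
  rewrite fineK// ge0_fin_numE; first by rewrite gt_min ltry orbT.
  by rewrite le_min g0 lee01.
have mf' : measurable_fun setT (fun x => (f x)%:E).
  by rewrite (_ : (fun x => (f x)%:E) = (fun x => Order.min (g x) 1%E));
    [exact: measurable_mine|apply/funext].
exists f; split.
- exact/measurable_EFinP.
- by move=> x; rewrite -!lee_fin fE le_min g0 lee01 ge_min lexx orbT.
- move=> A mA; rewrite pE//; apply: ge0_ae_eq_integral => //.
  + exact: measurable_funTS.
  + exact: measurable_funTS.
  + by move=> x _; rewrite fE le_min g0 lee01.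
  + apply: filterS g1 => x g1x _; rewrite fE.
    have [gx|gx] := leP (g x) 1%E => //.
    by rewrite g1x.
Qed.

Lemma exists_pushforward (R : realType) (d d' : measure_display)
  (T : measurableType d) (U : measurableType d')
  (m : {measure set T -> \bar R}) (h : T -> U) :
  measurable_fun setT h ->
  exists hm : {measure set U -> \bar R}, forall A, hm A = m (h @^-1` A).
Proof. by move=> mh; unshelve eexists (pushforward m h : {measure set _ -> \bar R}). Qed.

Section bounded_measure.
Context (R : realType) (d : measure_display) (T : measurableType d).
Variables (m : {measure set T -> \bar R}) (moo : (m setT < +oo)%E).

(** The proof of finite mass is an argument so that the finite-measure instance can be attached to
    the term. *)
Definition bounded_measure of (m setT < +oo)%E : set T -> \bar R := m.

HB.instance Definition _ := Measure.on (bounded_measure moo).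

Let fin_num_bounded_measure : fin_num_fun (bounded_measure moo).
Proof. exact: lty_fin_num_fun. Qed.

HB.instance Definition _ := @Measure_isFinite.Build _ _ _
  (bounded_measure moo) fin_num_bounded_measure.

End bounded_measure.

Lemma exists_density_measure (R : realType) (d : measure_display)
  (T : measurableType d) (m : {measure set T -> \bar R}) (f : T -> \bar R) :
  measurable_fun setT f -> (forall x, 0 <= f x)%E ->
  exists m' : {measure set T -> \bar R},
    forall A, m' A = (\int[m]_(x in A) f x)%E.
Proof.
move=> mf f0; pose nu A := (\int[m]_(x in A) f x)%E.
have nu0 : nu set0 = 0%E by rewrite /nu integral_set0.
have nu_ge0 A : (0 <= nu A)%E by apply: integral_ge0.
pose nuM := isMeasure.Build _ _ _ nu nu0 nu_ge0
  (semi_sigma_additive_nng_induced mf f0).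
pose m' : {measure set T -> \bar R} := HB.pack nu nuM.
by exists m'.
Qed.

(** If [f] is the density of [p] with respect to the image of [m] under [h], then [f \o h] splits
    [m] into the parts with densities [1 - f \o h] and [f \o h]; by change of variables the second
    has image [p]. With [h = snd] this selects the part of a joint law to be moved. *)
Lemma lift_dominated_measure (R : realType) (d d' : measure_display)
  (T : measurableType d) (U : measurableType d')
  (m : {finite_measure set T -> \bar R}) (h : T -> U)
  (p : {finite_measure set U -> \bar R}) :
  measurable_fun setT h ->
  (forall A, measurable A -> (p A <= m (h @^-1` A))%E) ->
  exists m1 m2 : {measure set T -> \bar R},
    (forall A, measurable A -> m A = m1 A + m2 A)%E /\
    (forall A, measurable A -> m2 (h @^-1` A) = p A).
Proof.
move=> mh pm.
have [hm hmE] := exists_pushforward m mh.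
have hmoo : (hm setT < +oo)%E.
  by rewrite hmE preimage_setT ltey_eq fin_num_measure.
pose fhm : {finite_measure set U -> \bar R} := bounded_measure hmoo.
have [|f [mf f01 pE]] := @dominated_density _ _ _ fhm p.
  by move=> A mA; rewrite [fhm A]hmE pm.
have mfh : measurable_fun setT (f \o h) by exact: measurableT_comp.
have [m1 m1E] : exists m' : {measure set T -> \bar R},
    forall A, m' A = (\int[m]_(x in A) (1 - (f \o h) x)%:E)%E.
  apply: exists_density_measure => [|x].
    by apply/measurable_EFinP; exact: measurable_funB.
  by rewrite lee_fin subr_ge0; have /andP[] := f01 (h x).
have [m2 m2E] : exists m' : {measure set T -> \bar R},
    forall A, m' A = (\int[m]_(x in A) ((f \o h) x)%:E)%E.
  apply: exists_density_measure => [|x]; first exact/measurable_EFinP.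
  by rewrite lee_fin; have /andP[] := f01 (h x).
exists m1, m2; split => A mA.
  rewrite m1E m2E -ge0_integralD//=.
  - under eq_integral do rewrite -EFinD subrK.
    by rewrite integral_cst// mul1e.
  - by move=> x _; rewrite lee_fin subr_ge0; have /andP[] := f01 (h x).
  - by apply: measurable_funTS; apply/measurable_EFinP; exact: measurable_funB.
  - by move=> x _; rewrite lee_fin; have /andP[] := f01 (h x).
  - by apply: measurable_funTS; apply/measurable_EFinP.
rewrite m2E pE//.
have -> : (fhm : set U -> \bar R) = pushforward m h.
  by apply/funext => B; exact: hmE.
rewrite ge0_integral_pushforward//.
  exact/measurable_EFinP/measurable_funTS.
by move=> y _; rewrite lee_fin; have /andP[] := f01 y.
Qed.

(** * Jordan decomposition and total variation *)

Lemma fin_num_subeq_addeq (R : realDomainType) (a b p n : \bar R) :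
  a \is a fin_num -> b \is a fin_num -> p \is a fin_num -> n \is a fin_num ->
  (a - b = p - n -> a + n = b + p)%E.
Proof.
case: a b p n => [a| |] [b| |] [p| |] [n| |] // _ _ _ _ [] abpn.
by rewrite -!EFinD; congr EFin; lra.
Qed.

(** With [P] a positive Hahn set of [mu - nu], [p A] is [mu - nu] on [A]&[P]. Dropping the [nu] term
    gives domination by [mu], and the total mass of [p] is the value of [mu - nu] at [P], one of the
    competitors in the supremum [dTV]. *)
Lemma dTV_jordan (R : realType) (d : measure_display) (T : measurableType d)
  (mu nu : probability T R) :
  exists p n : {finite_measure set T -> \bar R},
    [/\ forall A, measurable A -> (mu A + n A = nu A + p A)%E,
        forall A, measurable A -> (p A <= mu A)%E &
        (p setT <= dTV mu nu)%E].
Proof.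
pose c : {charge set T -> \bar R} := cadd (charge_of_finite_measure mu)
  (cscale (-1) (charge_of_finite_measure nu)).
have cE A : c A = (mu A - nu A)%E.
  by rewrite -[LHS]/(mu A + (-1)%:E * nu A)%E EFinN mulN1e.
have [P [N cPN]] := Hahn_decomposition c.
have [[mP Ppos] [mN Nneg] PUN PIN] := cPN.
have posE A : measurable A -> jordan_pos cPN A = (mu (A `&` P) - nu (A `&` P))%E.
  by move=> mA; rewrite jordan_posE cjordan_posE /crestr0 mem_set//= -cE.
exists (jordan_pos cPN), (jordan_neg cPN); split.
- move=> A mA; have := jordan_decomp cPN mA.
  rewrite cE -[RHS]/(jordan_pos cPN A + (-1)%:E * jordan_neg cPN A)%E.
  rewrite EFinN mulN1e.
  by apply: fin_num_subeq_addeq; rewrite fin_num_measure.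
- move=> A mA; rewrite [leLHS]posE//.
  have mAP : measurable (A `&` P) by exact: measurableI.
  apply: (@le_trans _ _ (mu (A `&` P))).
    by rewrite leeBlDr ?fin_num_measure// leeDl.
  by apply: le_measure; rewrite ?inE.
- rewrite [leLHS]posE// setTI; apply: le_trans (lee_abs _) _.
  by apply: ereal_sup_ubound; exists P.
Qed.

(** * Gluing a joint law to a prescribed second marginal *)

Lemma exists_probability_of_measure (R : realType) (d : measure_display)
  (T : measurableType d) (m : {measure set T -> \bar R}) :
  m setT = 1%E -> exists Q : probability T R, forall A, Q A = m A.
Proof.
(* The Dirac mass is the fallback of [mnormalize] for total mass zero or infinity; mass one excludes
   it. *)
move=> mT; pose Q : probability T R := mnormalize m (dirac point).
exists Q => A; rewrite -[LHS]/(mnormalize m (dirac point) A) /mnormalize mT.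
by rewrite onee_eq0 /= invr1 mule1.
Qed.

(* When [r = 0] the bound forces [x = 0], which absorbs the junk value [0^-1 = 0]. *)
Lemma mulVe_bounded (R : realFieldType) (r : R) (x : \bar R) :
  (0 <= x)%E -> (x <= r%:E)%E -> (r^-1%:E * (x * r%:E) = x)%E.
Proof.
case: x => [x| |]//; rewrite !lee_fin => x0 xr.
rewrite -!EFinM; congr EFin; have [r0|r0] := eqVneq r 0; last first.
  by rewrite mulrCA mulVf// mulr1.
have -> : x = 0 by apply/eqP; rewrite eq_le x0 andbT -r0.
by rewrite mul0r mulr0.
Qed.

(** The part [pi1] stays in place. The part [pi2], with second marginal [p], is replaced by a
    measure with the same first marginal and second marginal [n]. As [c <= 1], this replacement
    costs at most its mass [p setT]. *)
Lemma glue_measures (R : realType) (d d' : measure_display)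
  (T : measurableType d) (U : measurableType d')
  (pi : probability (T * U)%type R) (nu : probability U R)
  (p n : {finite_measure set U -> \bar R}) :
  (forall A, measurable A -> (pi (setT `*` A) + n A = nu A + p A)%E) ->
  (forall A, measurable A -> (p A <= pi (setT `*` A))%E) ->
  exists lam : probability (T * U)%type R,
    [/\ forall A, measurable A -> lam (A `*` setT) = pi (A `*` setT),
        forall A, measurable A -> lam (setT `*` A) = nu A &
        forall c : T * U -> \bar R, measurable_fun setT c ->
          (forall z, (0 <= c z <= 1)%E) ->
          (\int[lam]_z c z <= \int[pi]_z c z + p setT)%E].
Proof.
move=> pnE pnle.
have sndE (A : set U) : (@snd T U) @^-1` A = setT `*` A.
  by apply/seteqP; split => [z|z []].
have fstE (A : set T) : (@fst T U) @^-1` A = A `*` setT.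
  by apply/seteqP; split => [z|z []].
have [|pi1 [pi2 [piE pi2E]]] :=
    @lift_dominated_measure _ _ _ _ _ pi snd p measurable_snd.
  by move=> A mA; rewrite sndE pnle.
have pTfin : p setT \is a fin_num by rewrite fin_num_measure.
(* Mass balance on the whole space, where [pi] and [nu] both have mass one. *)
have npT : n setT = p setT.
  have := pnE _ measurableT; rewrite setXTT !probability_setT.
  by move/(congr1 (fun x => x - 1)%E); rewrite ![(1 + _)%E]addeC !addeK.
pose r := fine (p setT).
have rE : p setT = r%:E by rewrite fineK.
have r0 : 0 <= r by rewrite fine_ge0.
have rV0 : 0 <= r^-1 by rewrite invr_ge0.
have [a aE] := exists_pushforward pi2 measurable_fst.
have pi2T : pi2 setT = r%:E by rewrite -rE -pi2E ?preimage_setT.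
pose prod : {measure set (T * U) -> \bar R} := (a \x n)%E.
(* Both factors of [prod] have mass [r], so the weight [r^-1] restores each marginal; if [r = 0],
   both factors vanish. *)
pose lam0 : {measure set (T * U) -> \bar R} :=
  measure_add pi1 (mscale (NngNum rV0) prod).
have lam0E A B : measurable A -> measurable B ->
    lam0 (A `*` B) = (pi1 (A `*` B) + r^-1%:E * (pi2 (A `*` setT) * n B))%E.
  move=> mA mB; rewrite [LHS]measure_addE; congr (_ + _)%E.
  rewrite /mscale/= /prod; congr (_ * _)%E.
  by rewrite [LHS]product_measure1E// -fstE -aE.
have lam0l A : measurable A -> lam0 (A `*` setT) = pi (A `*` setT).
  move=> mA; have mAT : measurable (A `*` [set: U]) by exact: measurableX.
  rewrite lam0E// npT rE mulVe_bounded ?piE//.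
  by rewrite -pi2T; apply: le_measure; rewrite ?inE.
have lam0r A : measurable A -> lam0 (setT `*` A) = nu A.
  move=> mA; have mTA : measurable ([set: T] `*` A) by exact: measurableX.
  rewrite lam0E// setXTT pi2T [(r%:E * _)%E]muleC mulVe_bounded//; last first.
    by rewrite -rE -npT; apply: le_measure; rewrite ?inE.
  (* The goal is now [pi1 (setT]*[A) + n A = nu A]: the balance equation with [p A] cancelled. *)
  have := pnE _ mA; rewrite piE// -sndE pi2E// sndE => H.
  have pAfin : p A \is a fin_num by rewrite fin_num_measure.
  by rewrite -[LHS](addeK _ pAfin) [X in (X - _)%E]addeAC H addeK.
have lam0T : lam0 setT = 1%E by rewrite -setXTT lam0l// setXTT probability_setT.
have [lam lamE] := exists_probability_of_measure lam0T.
exists lam; split => [A mA|A mA|c mc c01].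
- by rewrite lamE lam0l.
- by rewrite lamE lam0r.
have c0 z : (0 <= c z)%E by have /andP[] := c01 z.
rewrite (@eq_measure_integral _ _ _ _ lam0); last by move=> A _ _; exact: lamE.
rewrite ge0_integral_measure_add// ge0_integral_mscale//=.
apply: leeD.
  rewrite [leRHS](@eq_measure_integral _ _ _ _ (measure_add pi1 pi2)); last first.
    by move=> A mA _; exact: etrans (piE _ mA) (esym (measure_addE _ _ _)).
  by rewrite ge0_integral_measure_add// leeDl// integral_ge0.
apply: (@le_trans _ _ (r^-1%:E * prod setT)%E).
  apply: lee_wpmul2l => //.
  rewrite -[leRHS]mul1e -integral_cst//.
  by apply: ge0_le_integral => // z _; have /andP[] := c01 z.
have -> : prod setT = (pi2 setT * n setT)%E.
  by rewrite -[in LHS]setXTT [LHS]product_measure1E// aE preimage_setT.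
by rewrite pi2T npT rE mulVe_bounded.
Qed.

(** [glue_measures] is applied to the law of [(X, Y)] with the Jordan parts of [lY - nu], so
    correcting the second marginal costs at most the total variation distance. *)
Lemma glue_coupling (R : realType) (d dO : measure_display)
  (E : measurableType d) (Omega : measurableType dO) (Pr : probability Omega R)
  (X Y : Omega -> E) (mu nu : probability E R) (c : E -> E -> R) :
  measurable_fun setT X -> measurable_fun setT Y ->
  (forall A, measurable A -> Pr (X @^-1` A) = mu A) ->
  measurable_fun setT (fun z : E * E => c z.1 z.2) ->
  (forall x y, 0 <= c x y <= 1) ->
  (W c mu nu <= \int[Pr]_w (c (X w) (Y w))%:E +
    dTV (fun A => Pr (Y @^-1` A)) nu)%E.
Proof.
move=> mX mY Xmu mc c01.
have mXY : measurable_fun setT (fun w => (X w, Y w)) by exact: measurable_fun_pair.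
pose XY : {mfun Omega >-> (E * E)%type} :=
  HB.pack (fun w => (X w, Y w)) (isMeasurableFun.Build _ _ _ _ _ mXY).
pose Y' : {mfun Omega >-> E} := HB.pack Y (isMeasurableFun.Build _ _ _ _ _ mY).
pose pi : probability (E * E)%type R := distribution Pr XY.
pose lY : probability E R := distribution Pr Y'.
have piE A : pi A = Pr [set w | A (X w, Y w)] by [].
have piTE A : pi (setT `*` A) = lY A.
  by rewrite piE; congr (Pr _); apply/seteqP; split => [w []|w].
have [p [n [pnE pnle pTV]]] := dTV_jordan lY nu.
have [||lam [lam1 lam2 lamW]] := @glue_measures _ _ _ _ _ pi nu p n.
- by move=> A mA; rewrite piTE pnE.
- by move=> A mA; rewrite piTE pnle.
have mcE : measurable_fun setT (fun z : E * E => (c z.1 z.2)%:E).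
  exact/measurable_EFinP.
apply: (@le_trans _ _ (\int[lam]_z (c z.1 z.2)%:E)%E).
  apply: ereal_inf_lbound; exists lam => // A mA; split; last exact: lam2.
  rewrite lam1// -Xmu// piE; congr (Pr _).
  by apply/seteqP; split => [w []|w].
apply: le_trans (lamW _ mcE _) _ => [z|]; first by rewrite !lee_fin.
apply: leeD => //.
rewrite -[leLHS]/(\int[pushforward Pr XY]_z (c z.1 z.2)%:E)%E.
rewrite ge0_integral_pushforward// => z _.
by rewrite lee_fin; have /andP[] := c01 z.1 z.2.
Qed.

(** * Product couplings, swapped couplings and the cost saved on a set *)

Lemma exists_product_coupling (R : realType) (d : measure_display)
  (E : measurableType d) (mu nu : probability E R) :
  exists2 lam : probability (E * E)%type R, coupling mu nu lam &
    forall A B, measurable A -> measurable B ->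
      lam (A `*` B) = (mu A * nu B)%E.
Proof.
pose prod : {measure set (E * E) -> \bar R} := (mu \x nu)%E.
have prodE A B : measurable A -> measurable B ->
    prod (A `*` B) = (mu A * nu B)%E by move=> mA mB; exact: product_measure1E.
have [|lam lamE] := @exists_probability_of_measure _ _ _ prod.
  by rewrite -setXTT prodE// !probability_setT mule1.
exists lam => [A mA|A B mA mB]; last by rewrite lamE prodE.
by split; rewrite lamE prodE// probability_setT ?mule1 ?mul1e.
Qed.

(** The coordinate swap turns a coupling of [nu] and [mu] into one of [mu] and [nu] with the same
    cost, [c] being symmetric. *)
Lemma W_swap_le (R : realType) (d : measure_display) (E : measurableType d)
  (mu nu : set E -> \bar R) (c : E -> E -> R) :
  measurable_fun setT (fun z : E * E => c z.1 z.2) ->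
  (forall x y, 0 <= c x y) -> (forall x y, c x y = c y x) ->
  (W c mu nu <= W c nu mu)%E.
Proof.
move=> mc c0 cC; apply: le_ereal_inf => _ [lam cpl <-].
have msw : measurable_fun setT (fun z : E * E => (z.2, z.1)).
  exact: measurable_fun_pair.
pose sw : {mfun (E * E)%type >-> (E * E)%type} :=
  HB.pack (fun z : E * E => (z.2, z.1)) (isMeasurableFun.Build _ _ _ _ _ msw).
pose lam' : probability (E * E)%type R := distribution lam sw.
exists lam' => [A mA|].
  have [l1 l2] := cpl A mA; split.
    rewrite -l2 -[LHS]/(lam (sw @^-1` (A `*` setT))); congr (lam _).
    by apply/seteqP; split => [z []|z []].
  rewrite -l1 -[LHS]/(lam (sw @^-1` (setT `*` A))); congr (lam _).
  by apply/seteqP; split => [z []|z []].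
rewrite -[LHS]/(\int[pushforward lam sw]_z (c z.1 z.2)%:E)%E.
rewrite ge0_integral_pushforward//.
- by rewrite preimage_setT; apply: eq_integral => z _ /=; rewrite cC.
- exact/measurable_EFinP.
- by move=> z _; rewrite lee_fin.
Qed.

(** Integrate the pointwise bound [c + 1/2 * \1_A <= 1]. *)
Lemma integral_le_one_sub_half (R : realType) (d : measure_display)
  (T : measurableType d) (lam : probability T R) (A : set T) (c : T -> R) :
  measurable A -> measurable_fun setT c ->
  (forall z, 0 <= c z <= 1) -> (forall z, A z -> c z <= 1 / 2) ->
  (\int[lam]_z (c z)%:E <= 1 - (1 / 2)%:E * lam A)%E.
Proof.
move=> mA mc c01 cA.
have iA : (\int[lam]_z ((1 / 2)%:E * (\1_A z)%:E) = (1 / 2)%:E * lam A)%E.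
  rewrite ge0_integralZl//.
  - by rewrite integral_indic// setIT.
  - exact/measurable_EFinP.
rewrite leeBrDr; last by rewrite -iA iA fin_numM// fin_num_measure.
rewrite -iA -ge0_integralD//.
- rewrite -(probability_setT lam) -[leRHS]mul1e -integral_cst//.
  apply: ge0_le_integral => //.
  + move=> z _; apply: adde_ge0; first by rewrite lee_fin; have /andP[] := c01 z.
    by rewrite -EFinM lee_fin mulr_ge0//; lra.
  + apply: emeasurable_funD; first exact/measurable_EFinP.
    by apply: measurable_funeM; exact/measurable_EFinP.
  + move=> z _; rewrite /cst indicE; have [|_] := boolP (z \in A).
      rewrite inE => /cA cz; rewrite -EFinM -EFinD lee_fin mulr1; lra.
    by rewrite mule0 adde0 lee_fin; have /andP[] := c01 z.
- by move=> z _; rewrite lee_fin; have /andP[] := c01 z.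
- exact/measurable_EFinP.
- by apply: measurable_funeM; exact/measurable_EFinP.
Qed.

(** * Measurability of lower semicontinuous functions on a Polish space *)

Lemma measurable_fun_gt_cst (R : realType) (d : measure_display)
  (T : measurableType d) (f : T -> R) :
  (forall c, measurable [set x | c < f x]) -> measurable_fun setT f.
Proof.
move=> mf; apply: (measurability _ (RGenOInfty.measurableE R)) => //.
move=> /= _ [_ [c ->] <-]; rewrite setTI.
rewrite (_ : _ @^-1` _ = [set x | c < f x])//.
by apply/seteqP; split => x /=; rewrite in_itv/= andbT.
Qed.

Section polish_lemmas.
Context (R : realType) (d : measure_display) (E : measurableType d).
Variable rho : E -> E -> R.
Hypothesis rhoP : polish_borel rho.

Lemma measurable_rho_ball x (e : R) : measurable [set y | rho x y < e].
Proof.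
have [[rho0 rhoE rhoC rhoD] _ _ ->] := rhoP.
apply: sub_sigma_algebra => y /= xy; exists (e - rho x y).
split; first by rewrite subr_gt0.
by move=> z yz; apply: le_lt_trans (rhoD x y z) _; rewrite addrC -ltrBrDr.
Qed.

Lemma polish_dense_seq : exists u : nat -> E,
  forall x (e : R), 0 < e -> exists n, rho x (u n) < e.
Proof.
have [_ _ [D [cD dD]] _] := rhoP.
have /pfcard_geP[D0|[g]] := cD.
  exists (fun=> point) => x e e0; have [y [Dy _]] := dD x e e0.
  by rewrite D0 in Dy.
exists g => x e e0; have [y [Dy xy]] := dD x e e0.
by have [n _ gn] := 'surj_g Dy; exists n; rewrite gn.
Qed.

(** Superlevel sets are open, and separability makes each a countable union of products of balls
    with centres in a dense sequence and radii [1/(k+1)], hence a member of the product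
    sigma-algebra. *)
Lemma lsc2_measurable (f : E -> E -> R) : lsc2 rho f ->
  measurable_fun setT (fun z : E * E => f z.1 z.2).
Proof.
move=> lf; apply: measurable_fun_gt_cst => c.
have [[rho0 rhoE rhoC rhoD] _ _ _] := rhoP.
have [u du] := polish_dense_seq.
pose B i (k : nat) := [set y | rho (u i) y < k.+1%:R^-1].
pose good i j k := B i k `*` B j k `<=` [set z : E * E | c < f z.1 z.2].
rewrite (_ : [set z : E * E | _] =
  \bigcup_i \bigcup_j \bigcup_(k in good i j) (B i k `*` B j k)).
  apply: bigcupT_measurable => i; apply: bigcupT_measurable => j.
  apply: bigcup_measurable => k _.
  by apply: measurableX; exact: measurable_rho_ball.
apply/seteqP; split; last by move=> z [i _ [j _ [k gk]]]; exact: gk.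
move=> [x y] /= cf; have [e [e0 fe]] := lf x y c cf.
(* With radius below [e / 2], any two points of one ball are closer than [e], so balls around dense
   points near [x] and [y] stay where [f] exceeds [c]. *)
have [k ke] : exists k : nat, k.+1%:R^-1 < e / 2 :> R.
  have e2 : 0 < e / 2 by rewrite divr_gt0.
  exists (Num.truncn (e / 2)^-1).
  by rewrite invf_plt ?posrE// truncnS_gt.
have k0 : 0 < k.+1%:R^-1 :> R by rewrite invr_gt0.
have [i xi] := du x _ k0; have [j yj] := du y _ k0.
exists i => //; exists j => //; exists k.
  have near a b v : rho a v < k.+1%:R^-1 -> rho v b < k.+1%:R^-1 -> rho a b < e.
    move=> av vb; apply: le_lt_trans (rhoD a v b) _.
    by move: av vb ke; set q := k.+1%:R^-1 => *; lra.
  by move=> [x' y'] [/= Bx By]; apply: fe; [exact: near xi Bx|exact: near yj By].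
by split; rewrite /B/= rhoC.
Qed.

End polish_lemmas.

(** * The truncated symmetrised cost [dN] *)

Section dN_lemmas.
Context (R : realType) (d : measure_display) (E : measurableType d).
Variables (rho theta : E -> E -> R) (N : R).
Hypotheses (thetaP : premetric rho theta) (N0 : 0 < N).

Lemma dN_01 x y : 0 <= dN theta N x y <= 1.
Proof.
have [t0 _ _] := thetaP.
by rewrite /dN !le_min !mulr_ge0 ?(ltW N0)// ge_min lexx orbT ler01.
Qed.

Lemma dN_sym x y : dN theta N x y = dN theta N y x.
Proof. by rewrite /dN [in LHS]minC [Num.min (N * theta x y) _]minC minC. Qed.

Lemma dN_le x y : dN theta N x y <= N * theta x y.
Proof. by rewrite /dN !ge_min lexx. Qed.

Lemma dN_distance_like : distance_like rho (dN theta N).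
Proof.
have [t0 tl tE] := thetaP; split.
- by move=> x y; have /andP[] := dN_01 x y.
- exact: dN_sym.
- move=> x y c; rewrite /dN !lt_min => /andP[/andP[cxy cyx] c1].
  have N_lt z : (c < N * z) = (c / N < z) by rewrite ltr_pdivrMr// mulrC.
  have [|e1 [e10 h1]] := tl x y (c / N); first by rewrite -N_lt.
  have [|e2 [e20 h2]] := tl y x (c / N); first by rewrite -N_lt.
  exists (Num.min e1 e2); split; first by rewrite lt_min e10.
  move=> x' y'; rewrite !lt_min => /andP[x1 x2] /andP[y1 y2].
  by rewrite c1 !N_lt h1// h2.
- move=> x y; split=> [|->].
    rewrite /dN; case: leP => // _; last by move/eqP; rewrite oner_eq0.
    by case: leP => _ /eqP; rewrite mulf_eq0 (gt_eqF N0) /= => /eqP/tE ->.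
  by rewrite /dN (proj2 (tE y y) erefl) mulr0 minxx min_l.
Qed.

Lemma measurable_dN : polish_borel rho ->
  measurable_fun setT (fun z : E * E => dN theta N z.1 z.2).
Proof.
by move=> rhoP; have [_ _ dl _] := dN_distance_like; exact: lsc2_measurable dl.
Qed.

End dN_lemmas.

(** * From the assumptions on processes to contraction and smallness *)

Lemma has_law_Px_marginal (R : realType) (d dO : measure_display)
  (E : measurableType d) (Omega : measurableType dO) (Pr : probability Omega R)
  (P : R -> E -> probability E R) (x : E) (X : R -> Omega -> E)
  (t : R) (A : set E) :
  has_law_Px Pr P x X -> 0 <= t -> measurable A ->
  Pr (X t @^-1` A) = P t x A.
Proof.
move=> [_ fdd] t0 mA; have := fdd [:: (t, A)]; rewrite /= subr0.
under eq_integral do rewrite mule1.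
rewrite integral_indic// setIT => <-//; congr (Pr _).
apply/seteqP; split => [w /= XA p|w /= XA]; first by rewrite inE => /eqP ->.
by apply: (XA (t, A)); rewrite inE.
Qed.

(** The common bound for (i) and (iii): [glue_coupling] with [dN <= N * theta]. Lower semicontinuity
    makes both costs measurable. *)
Lemma W_dN_le (R : realType) (d dO : measure_display)
  (E : measurableType d) (rho theta : E -> E -> R) (N : R)
  (Omega : measurableType dO) (Pr : probability Omega R)
  (X Y : Omega -> E) (mu nu : probability E R) (a b : R) :
  polish_borel rho -> premetric rho theta -> 0 < N ->
  measurable_fun setT X -> measurable_fun setT Y ->
  (forall A, measurable A -> Pr (X @^-1` A) = mu A) ->
  (\int[Pr]_w (theta (X w) (Y w))%:E <= a%:E)%E ->
  (dTV (fun A => Pr (Y @^-1` A)) nu <= b%:E)%E ->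
  (W (dN theta N) mu nu <= (N * a + b)%:E)%E.
Proof.
move=> rhoP thetaP N0 mX mY Xmu tha tvb.
have [t0 tl _] := thetaP.
have mXY : measurable_fun setT (fun w => (X w, Y w)) by exact: measurable_fun_pair.
have mth : measurable_fun setT (fun w => (theta (X w) (Y w))%:E).
  apply/measurable_EFinP.
  exact: (measurableT_comp (lsc2_measurable rhoP tl) mXY).
have mdN := measurable_dN thetaP N0 rhoP.
apply: le_trans (glue_coupling nu mX mY Xmu mdN (dN_01 thetaP N0)) _.
rewrite EFinD; apply: leeD => //.
apply: (@le_trans _ _ (\int[Pr]_w (N%:E * (theta (X w) (Y w))%:E))%E).
  apply: ge0_le_integral => //.
  - by move=> w _; rewrite lee_fin; have /andP[] := dN_01 thetaP N0 (X w) (Y w).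
  - by apply/measurable_EFinP; exact: (measurableT_comp mdN mXY).
  - by apply: measurable_funeM.
  - by move=> w _; rewrite -EFinM lee_fin dN_le.
rewrite ge0_integralZl//.
- by rewrite EFinM lee_wpmul2l// lee_fin ltW.
- by move=> w _; rewrite lee_fin.
- by rewrite lee_fin ltW.
Qed.

Lemma small_of_W_le (R : realType) (d : measure_display)
  (E : measurableType d) (c : E -> E -> R) (P : R -> E -> probability E R)
  (t : R) (B : set E) (e : R) : 0 < e ->
  (forall x y, B x -> B y -> (W c (P t x) (P t y) <= (1 - e)%:E)%E) ->
  small c P t B.
Proof.
move=> e0 We; exists e; split => //.
by apply: ge_ereal_sup => _ [x Bx [y By <-]]; exact: We.
Qed.

Theorem theorem2p5 (R : realType) (d : measure_display) (E : measurableType d)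
  (rho : E -> E -> R) (theta : E -> E -> R) (P : R -> E -> probability E R) :
  polish_borel rho -> premetric rho theta -> markov_tf P ->
  [/\ (* (i) *)
      forall r L : R -> R, assumptionA theta P r L ->
        forall N t : R, 0 < N -> 0 < t -> r t <= 1 / 3 -> 2 * L t <= N ->
          contracting rho (dN theta N) P t,
      (* (ii) *)
      forall (B : set E) (t0 : R), 0 < t0 -> assumptionB1 theta P B t0 ->
        forall N : R, 0 < N -> small (dN theta N) P t0 B &
      (* (iii) *)
      forall (B : set E) (Rf : R -> R) (eps : R), 0 < eps ->
        assumptionB2 theta P B Rf eps ->
        forall N t : R, 0 < N -> 0 < t -> N * Rf t <= eps / 2 ->
          small (dN theta N) P t B].
Proof.
move=> rhoP thetaP _; have [t0 _ _] := thetaP; split.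
- move=> r L [_ _ AXY] N t N0 tgt0 rt Lt; have tge0 := ltW tgt0.
  have mdN := measurable_dN thetaP N0 rhoP.
  split; first exact: dN_distance_like.
    by move=> x y; have /andP[] := dN_01 thetaP N0 x y.
  (* The constant is [1/3 + 1/2]: [r t <= 1/3] bounds the transport term, and [L t <= N / 2] the
     total variation term. *)
  have step x y :
      (W (dN theta N) (P t x) (P t y) <= (5 / 6 * (N * theta x y))%:E)%E.
    have [dO [S [Pr [X [Y [lX mY tvY thXY]]]]]] := AXY x y.
    have [mX _] := lX.
    apply: le_trans (W_dN_le rhoP thetaP N0 (mX _ tge0) (mY _ tge0) _
      (thXY _ tge0) (tvY _ tge0)) _ => [A mA|].
      exact: has_law_Px_marginal lX tge0 mA.
    rewrite lee_fin.
    have rth : r t * theta x y <= 1 / 3 * theta x y by rewrite ler_wpM2r.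
    have Lth : 2 * L t * theta x y <= N * theta x y by rewrite ler_wpM2r.
    have := ler_wpM2l (ltW N0) rth; lra.
  exists (5 / 6); split=> [|x y dxy]; first by lra.
  (* Below [1], [dN] is [N] times the smaller of the two values of [theta]. If that is [theta y x],
     [step] is used with the points exchanged and [W] is swapped back. *)
  have [xy|yx] := leP (theta x y) (theta y x).
    suff -> : dN theta N x y = N * theta x y by exact: step.
    move: dxy; rewrite /dN [Num.min (N * _) _]min_l ?ler_pM2l//.
    by rewrite gt_min ltxx orbF => /ltW /min_l.
  suff -> : dN theta N x y = N * theta y x.
    apply: le_trans (step y x); apply: W_swap_le => //.
      by move=> x' y'; have /andP[] := dN_01 thetaP N0 x' y'.
    exact: dN_sym.
  move: dxy; rewrite /dN [Num.min (N * _) _]min_r; last by rewrite ler_pM2l// ltW.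
  by rewrite gt_min ltxx orbF => /ltW /min_l.
- move=> B u ugt0 AB1 N N0; have mdN := measurable_dN thetaP N0 rhoP.
  (* This diameter makes [N * theta <= 1/2] on [D]. *)
  have [|D [mD infD supD]] := AB1 (2 * N)^-1; first by rewrite invr_gt0 mulr_gt0.
  (* The infimum is [+oo] when [B] is empty; in that case [delta = 1] serves. *)
  have [delta delta0 deltaD] : exists2 delta : R, 0 < delta &
      forall x, B x -> (delta%:E <= P u x D)%E.
    move: infD; case infE : (ereal_inf _) => [q| |]// q0.
      by exists q => // x Bx; rewrite -infE; apply: ereal_inf_lbound; exists x.
    exists 1 => // x Bx; suff : (+oo <= P u x D)%E by apply: le_trans; rewrite leey.
    by rewrite -infE; apply: ereal_inf_lbound; exists x.
  have dND x y : D x -> D y -> dN theta N x y <= 1 / 2.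
    move=> Dx Dy; apply: le_trans (dN_le _ _ _ _) _.
    have : theta x y <= (2 * N)^-1.
      by rewrite -lee_fin (le_trans _ supD)//; apply: ereal_sup_ubound;
        exists x => //; exists y.
    rewrite invfM => th; have := ler_wpM2l (ltW N0) th.
    by rewrite mulrCA divff ?gt_eqF// mulr1 div1r.
  (* The product coupling gives [D]*[D] mass at least [delta * delta], and there the cost is at most
     [1/2]. *)
  apply: (@small_of_W_le _ _ _ _ _ _ _ (1 / 2 * (delta * delta))).
    by rewrite !mulr_gt0.
  move=> x y Bx By.
  have [lam cpl lamE] := exists_product_coupling (P u x) (P u y).
  apply: (@le_trans _ _ (\int[lam]_z (dN theta N z.1 z.2)%:E)%E).
    by apply: ereal_inf_lbound; exists lam.
  apply: le_trans (@integral_le_one_sub_half _ _ _ lam (D `*` D) _ _ mdN _ _) _.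
  + exact: measurableX.
  + by move=> z; exact: dN_01 thetaP N0 _ _.
  + by move=> z [Dz1 Dz2]; exact: dND.
  rewrite lamE// EFinB leeB// EFinM lee_wpmul2l//.
  by rewrite EFinM lee_pmul ?deltaD// lee_fin ltW.
- move=> B Rf eps eps0 [_ _ _ BXY] N t N0 tgt0 NR; have tge0 := ltW tgt0.
  (* The bound [N * Rf t + (1 - eps)] is at most [1 - eps / 2]. *)
  apply: (@small_of_W_le _ _ _ _ _ _ _ (eps / 2)); first by rewrite divr_gt0.
  move=> x y Bx By.
  have [dO [S [Pr [X [Y [lX mY tvY thXY]]]]]] := BXY x y Bx By.
  have [mX _] := lX.
  apply: le_trans (W_dN_le rhoP thetaP N0 (mX _ tge0) (mY _ tge0) _
    (thXY _ tge0) (tvY _ tge0)) _ => [A mA|].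
    exact: has_law_Px_marginal lX tge0 mA.
  by rewrite lee_fin; lra.
Qed.
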